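(* Let $Q$ be a divisible unital quantale. For any fuzzy context $(\mathsf{A},\mathsf{B},\phi)$, the formal concept lattice $\mathcal{M}_{\phi}(\mathsf{A},\mathsf{B})$ is a separated and complete $Q$-preordered $Q$-subset. Conversely, each separated and complete $Q$-preordered $Q$-subset $\mathbb{A}$ is isomorphic to the formal concept lattice $\mathcal{M}_{\phi}(\mathsf{A},\mathsf{B})$ of some fuzzy context $(\mathsf{A},\mathsf{B},\phi)$.
   Context: A unital quantale is a complete lattice $Q$ with a monoid operation $\&$ (unit $I$) preserving arbitrary joins in each variable; $a\backslash b$ and $b/a$ are determined by $c\le a\backslash b\iff a\& c\le b$ and $c\le b/a\iff c\& a\le b$. It is divisible if $a\le b$ implies $x\& b=a=b\& y$ for some $x,y\in Q$; then $I$ is the top element. A divisible unital quantale $Q$ induces a small quantaloid $\mathcal{Q}$ (a category whose hom-sets are complete lattices with composition preserving joins in each variable): objects are the elements of $Q$; $\mathcal{Q}(X,Y)=\{\alpha\in Q:\alpha\le X\wedge Y\}$ with order from $Q$; composition of $\alpha\in\mathcal{Q}(X,Y)$ and $\beta\in\mathcal{Q}(Y,Z)$ is $\beta\circ\alpha=\beta\&(Y\backslash\alpha)=(\beta/Y)\&\alpha$; the identity on $X$ is $X$. In a quantaloid, for $f:X\to Y$, $g:Y\to Z$, $h:X\to Z$, $h\swarrow f:Y\to Z$ is the largest arrow with $(h\swarrow f)\circ f\le h$, and $g\searrow h:X\to Y$ is the largest arrow with $g\circ(g\searrow h)\le h$. A $\mathcal{Q}$-category $\mathbb{A}$ is a set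 $\mathbb{A}_0$ with a type map $t$ to the objects of $\mathcal{Q}$ and hom-arrows $\mathbb{A}(x,y)\in\mathcal{Q}(tx,ty)$ with $1_{tx}\le\mathbb{A}(x,x)$ and $\mathbb{A}(y,z)\circ\mathbb{A}(x,y)\le\mathbb{A}(x,z)$. A $\mathcal{Q}$-functor is a type-preserving map with $\mathbb{A}(x,x')\le\mathbb{B}(Fx,Fx')$; isomorphisms are bijective ones with equality. A $\mathcal{Q}$-distributor $\phi:\mathbb{A}\rightsquigarrow\mathbb{B}$ assigns to $(x,y)\in\mathbb{A}_0\times\mathbb{B}_0$ an arrow $\phi(x,y)\in\mathcal{Q}(tx,ty)$ with $\mathbb{B}(y',y)\circ\phi(x,y')\le\phi(x,y)$ and $\phi(x',y)\circ\mathbb{A}(x,x')\le\phi(x,y)$; distributors form a quantaloid with pointwise order, composition $(\psi\circ\phi)(x,z)=\bigvee_y\psi(y,z)\circ\phi(x,y)$, and implications $(\eta\swarrow\phi)(y,z)=\bigwedge_x\eta(x,z)\swarrow\phi(x,y)$, $(\psi\searrow\eta)(x,y)=\bigwedge_z\psi(y,z)\searrow\eta(x,z)$. $*_X$ is the $\mathcal{Q}$-category with one object of type $X$ and hom-arrow $1_X$. $\mathcal{P}\mathbb{A}$ has as objects of type $X$ the distributors $\mu:\mathbb{A}\rightsquigarrow *_X$, with $\mathcal{P}\mathbb{A}(\mu,\lambda)=\lambda\swarrow\mu$. $\mathcal{P}^{\dagger}\mathbb{A}$ has as objects of type $X$ the distributors $\mu:*_X\rightsquigarrow\mathbb{A}$,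 with $\mathcal{P}^{\dagger}\mathbb{A}(\mu,\lambda)=\lambda\searrow\mu$. For $\phi:\mathbb{A}\rightsquigarrow\mathbb{B}$: $\phi_{\uparrow}:\mathcal{P}\mathbb{A}\to\mathcal{P}^{\dagger}\mathbb{B}$, $\phi_{\uparrow}(\mu)=\phi\swarrow\mu$, and $\phi^{\downarrow}:\mathcal{P}^{\dagger}\mathbb{B}\to\mathcal{P}\mathbb{A}$, $\phi^{\downarrow}(\lambda)=\lambda\searrow\phi$. A $Q$-preordered $Q$-subset is a $\mathcal{Q}$-category for this $\mathcal{Q}$ (so $tx=\mathbb{A}(x,x)$). It is separated if it is skeletal: $tx=ty$, $1_{tx}\le\mathbb{A}(x,y)$ and $1_{tx}\le\mathbb{A}(y,x)$ imply $x=y$. It is complete if for every $\mu\in\mathcal{P}\mathbb{A}$ there is $a\in\mathbb{A}_0$ with $\mathbb{A}(a,-)=\mathbb{A}\swarrow\mu$ (equivalently, it has all weighted limits). A $Q$-subset $\mathsf{A}$ is a set $\mathsf{A}_0$ with a map $\mathsf{A}:\mathsf{A}_0\to Q$; it is regarded as a discrete $\mathcal{Q}$-category with $tx=\mathsf{A}x$, $\mathsf{A}(x,x)=\mathsf{A}x$ and $\mathsf{A}(x,y)=0$ (bottom) for $x\ne y$. A $Q$-relation $\phi:\mathsf{A}\rightsquigarrow\mathsf{B}$ is a distributor between these discrete $\mathcal{Q}$-categories, i.e. a map $\phi:\mathsf{A}_0\times\mathsf{B}_0\to Q$ with $\phi(x,y)\le\mathsf{A}x\wedge\mathsf{B}y$.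 A fuzzy context is a triple $(\mathsf{A},\mathsf{B},\phi)$ of $Q$-subsets $\mathsf{A},\mathsf{B}$ and a $Q$-relation $\phi:\mathsf{A}\rightsquigarrow\mathsf{B}$. Its formal concept lattice $\mathcal{M}_{\phi}(\mathsf{A},\mathsf{B})$ has as objects the pairs $(\mu,\lambda)\in(\mathcal{P}\mathsf{A})_0\times(\mathcal{P}^{\dagger}\mathsf{B})_0$ with $\lambda=\phi_{\uparrow}(\mu)$ and $\mu=\phi^{\downarrow}(\lambda)$, of type $t\mu=t\lambda$, with hom $\mathcal{M}_{\phi}(\mathsf{A},\mathsf{B})((\mu,\lambda),(\mu',\lambda'))=\mathcal{P}\mathsf{A}(\mu,\mu')=\mathcal{P}^{\dagger}\mathsf{B}(\lambda,\lambda')$. *)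

(* Defs.v *)
From HB Require Import structures.
From mathcomp Require Import all_boot all_order.
From mathcomp Require Import boolp classical_sets.

Set Implicit Arguments.
Unset Strict Implicit.
Unset Printing Implicit Defensive.

Import Order.TTheory.
Local Open Scope classical_set_scope.
Local Open Scope group_scope.
Local Open Scope order_scope.

Declare Scope quantaloid_scope.
Delimit Scope quantaloid_scope with qd.
Local Open Scope quantaloid_scope.

HB.mixin Record TBLattice_isComplete (d : Order.disp_t) T
    of Order.TBLattice d T := {
  csup : set T -> T;
  csup_isLub : forall S : set T, isLub S (csup S)
}.

#[short(type="completeLatticeType")]
HB.structure Definition CompleteLattice d :=
  {T of TBLattice_isComplete d T & Order.TBLattice d T}.

HB.factory Record POrder_isCompleteLattice (d : Order.disp_t) T
    of Order.POrder d T := {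
  psup : set T -> T;
  psup_isLub : forall S : set T, isLub S (psup S)
}.

HB.builders Context d T of POrder_isCompleteLattice d T.

Let pinf (S : set T) := psup (lbound S).
Let join (x y : T) := psup [set z | z = x \/ z = y].
Let meet (x y : T) := pinf [set z | z = x \/ z = y].

Let le_meet x y z : (x <= meet y z) = (x <= y) && (x <= z).
Proof.
have [ub lub] := psup_isLub (lbound [set w | w = y \/ w = z]).
apply/idP/andP => [xm|[xy xz]]; last by apply: ub => w [] ->.
by split; apply: le_trans xm _; apply: lub => w; apply; [left|right].
Qed.

Let join_le x y z : (join x y <= z) = (x <= z) && (y <= z).
Proof.
have [ub lub] := psup_isLub [set w | w = x \/ w = y].
apply/idP/andP => [xm|[xz yz]]; last by apply: lub => w [] ->.
by split; apply: le_trans xm; apply: ub; [left|right].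
Qed.

HB.instance Definition _ :=
  Order.POrder_MeetJoin_isLattice.Build d T le_meet join_le.

Let bot_le x : psup set0 <= x.
Proof. by have [_] := psup_isLub set0; apply => y. Qed.

Let le_top x : x <= psup setT.
Proof. by have [ub _] := psup_isLub setT; apply: ub. Qed.

HB.instance Definition _ := Order.hasBottom.Build d T bot_le.
HB.instance Definition _ := Order.hasTop.Build d T le_top.
HB.instance Definition _ := TBLattice_isComplete.Build d T psup_isLub.

HB.end.

Section CompleteLatticeTheory.
Context {d : Order.disp_t} {T : completeLatticeType d}.
Implicit Types (S : set T) (x y : T).

Definition cinf S : T := csup (lbound S).

Lemma csup_ub S x : S x -> x <= csup S.
Proof. by have [ub _] := csup_isLub S; apply: ub. Qed.

Lemma csup_le S y : (forall x, S x -> x <= y) -> csup S <= y.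
Proof. by have [_ lub] := csup_isLub S => h; apply: lub. Qed.

Lemma cinf_lb S x : S x -> cinf S <= x.
Proof. by move=> Sx; apply: csup_le => y; apply. Qed.

Lemma le_cinf S y : (forall x, S x -> y <= x) -> y <= cinf S.
Proof. by move=> h; apply: csup_ub. Qed.

Lemma csup_pair x y : x <= y -> csup [set x; y] = y.
Proof.
move=> xy; apply: le_anti; apply/andP; split.
  by apply: csup_le => z [] ->.
by apply: csup_ub; right.
Qed.

End CompleteLatticeTheory.

HB.mixin Record Lattice_isQuantale (d : Order.disp_t) Q
    of CompleteLattice d Q & Monoid Q := {
  mulg_csup : forall (a : Q) (S : set Q), a * csup S = csup [set a * x | x in S];
  csup_mulg : forall (a : Q) (S : set Q), csup S * a = csup [set x * a | x in S]
}.

#[short(type="unitalQuantaleType")]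
HB.structure Definition UnitalQuantale d :=
  {Q of Lattice_isQuantale d Q & CompleteLattice d Q & Monoid Q}.

HB.mixin Record Quantale_isDivisible (d : Order.disp_t) Q
    of UnitalQuantale d Q := {
  divisible : forall a b : Q, a <= b -> exists x y, x * b = a /\ a = b * y
}.

#[short(type="divQuantaleType")]
HB.structure Definition DivQuantale d :=
  {Q of Quantale_isDivisible d Q & UnitalQuantale d Q}.

Section QuantaleTheory.
Context {d : Order.disp_t} {Q : unitalQuantaleType d}.
Implicit Types a b c : Q.

(** [ldiv a b] is a \ b and [rdiv b a] is b / a. *)
Definition ldiv a b : Q := csup [set c | a * c <= b].
Definition rdiv b a : Q := csup [set c | c * a <= b].

Lemma lemul2l a b c : b <= c -> a * b <= a * c.
Proof.
move=> bc; rewrite -(csup_pair bc) mulg_csup; apply: csup_ub.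
by exists b => //; left.
Qed.

Lemma lemul2r a b c : b <= c -> b * a <= c * a.
Proof.
move=> bc; rewrite -(csup_pair bc) csup_mulg; apply: csup_ub.
by exists b => //; left.
Qed.

Lemma le_ldiv a b c : (c <= ldiv a b) = (a * c <= b).
Proof.
apply/idP/idP => [cab|acb]; last exact: csup_ub.
apply: le_trans (lemul2l a cab) _; rewrite /ldiv mulg_csup.
by apply: csup_le => _ [x abx <-].
Qed.

Lemma le_rdiv a b c : (c <= rdiv b a) = (c * a <= b).
Proof.
apply/idP/idP => [cab|acb]; last exact: csup_ub.
apply: le_trans (lemul2r a cab) _; rewrite /rdiv csup_mulg.
by apply: csup_le => _ [x abx <-].
Qed.

End QuantaleTheory.

Section DivQuantaleTheory.
Context {d : Order.disp_t} {Q : divQuantaleType d}.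
Implicit Types a b c : Q.

Lemma one_top a : a <= 1.
Proof.
have [_ [y [_ e1]]] := divisible _ _ (lex1 (1%g : Q)).
suff -> : (1%g : Q) = \top by exact: lex1.
have tt : (\top : Q) * \top = \top.
  apply: le_anti; rewrite lex1 /=.
  by rewrite -{1}[\top]mulg1; apply/lemul2l/lex1.
by rewrite e1 -[in LHS]tt -mulgA -e1 mulg1.
Qed.

Lemma mul_ldiv a b : a <= b -> b * ldiv b a = a.
Proof.
move=> ab; apply: le_anti; rewrite -le_ldiv lexx /=.
have [_ [y [_ e]]] := divisible _ _ ab.
by rewrite [leLHS]e; apply: lemul2l; rewrite le_ldiv -e.
Qed.

Lemma mul_rdiv a b : a <= b -> rdiv a b * b = a.
Proof.
move=> ab; apply: le_anti; rewrite -le_rdiv lexx /=.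
have [x [_ [e _]]] := divisible _ _ ab.
by rewrite -[leLHS]e; apply: lemul2r; rewrite le_rdiv e.
Qed.

End DivQuantaleTheory.

Record quantaloid (d : Order.disp_t) := Quantaloid {
  ob :> Type;
  hom : ob -> ob -> completeLatticeType d;
  qcomp : forall X Y Z : ob, hom Y Z -> hom X Y -> hom X Z;
  qid : forall X : ob, hom X X;
  qcompA : forall (X Y Z W : ob) (h : hom Z W) (g : hom Y Z) (f : hom X Y),
    qcomp h (qcomp g f) = qcomp (qcomp h g) f;
  qcomp1l : forall (X Y : ob) (f : hom X Y), qcomp (qid Y) f = f;
  qcomp1r : forall (X Y : ob) (f : hom X Y), qcomp f (qid X) = f;
  qcomp_csupl : forall (X Y Z : ob) (S : set (hom Y Z)) (f : hom X Y),
    qcomp (csup S) f = csup [set qcomp g f | g in S];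
  qcomp_csupr : forall (X Y Z : ob) (g : hom Y Z) (S : set (hom X Y)),
    qcomp g (csup S) = csup [set qcomp g f | f in S]
}.
Arguments hom {d q} X Y.
Arguments qid {d q} X.

Notation "g ⊚ f" := (qcomp g f)
  (at level 40, left associativity) : quantaloid_scope.

Section QuantaloidTheory.
Context {d : Order.disp_t} {K : quantaloid d}.
Implicit Types X Y Z W : K.

Definition limpl X Y Z (h : hom X Z) (f : hom X Y) : hom Y Z :=
  csup [set g | g ⊚ f <= h].
Definition rimpl X Y Z (g : hom Y Z) (h : hom X Z) : hom X Y :=
  csup [set f | g ⊚ f <= h].

Lemma qcomp_le X Y Z (g g' : hom Y Z) (f f' : hom X Y) :
  g <= g' -> f <= f' -> g ⊚ f <= g' ⊚ f'.
Proof.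
move=> gg ff; apply: (@le_trans _ _ (g' ⊚ f)).
  rewrite -(csup_pair gg) qcomp_csupl; apply: csup_ub.
  by exists g => //; left.
rewrite -(csup_pair ff) qcomp_csupr; apply: csup_ub.
by exists f => //; left.
Qed.

Lemma le_limpl X Y Z (h : hom X Z) (f : hom X Y) (g : hom Y Z) :
  (g <= limpl h f) = (g ⊚ f <= h).
Proof.
apply/idP/idP => [gl|gf]; last exact: csup_ub.
apply: le_trans (qcomp_le gl (lexx f)) _; rewrite /limpl qcomp_csupl.
by apply: csup_le => _ [x xh <-].
Qed.

Lemma le_rimpl X Y Z (g : hom Y Z) (h : hom X Z) (f : hom X Y) :
  (f <= rimpl g h) = (g ⊚ f <= h).
Proof.
apply/idP/idP => [fl|gf]; last exact: csup_ub.
apply: le_trans (qcomp_le (lexx g) fl) _; rewrite /rimpl qcomp_csupr.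
by apply: csup_le => _ [x xh <-].
Qed.

(** Arrows of propositionally equal types live in different Rocq types, so
    statements comparing them transport along the equalities of types. *)
Definition hom_cast X X' Y Y' (eX : X = X') (eY : Y = Y') (f : hom X Y) :
    hom X' Y' :=
  ecast V (hom X' V) eY (ecast V (hom V Y) eX f).

End QuantaloidTheory.

Notation "h ↙ f" := (limpl h f)
  (at level 45, no associativity) : quantaloid_scope.
Notation "g ↘ h" := (rimpl g h)
  (at level 45, no associativity) : quantaloid_scope.

Record qcat d (K : quantaloid d) := QCat {
  obj :> Type;
  typ : obj -> K;
  qhom : forall x y : obj, hom (typ x) (typ y);
  qhom_id : forall x, qid (typ x) <= qhom x x;
  qhom_comp : forall x y z, qhom y z ⊚ qhom x y <= qhom x z
}.
Arguments qhom {d K} A x y : rename.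

Record qfunctor d (K : quantaloid d) (A B : qcat K) := QFunctor {
  fmap :> A -> B;
  fmap_typ : forall x, typ x = typ (fmap x);
  fmap_hom : forall x x',
    hom_cast (fmap_typ x) (fmap_typ x') (qhom A x x') <= qhom B (fmap x) (fmap x')
}.

Definition isomorphic d (K : quantaloid d) (A B : qcat K) : Prop :=
  exists F : qfunctor A B, bijective F /\
    forall x x', hom_cast (fmap_typ F x) (fmap_typ F x') (qhom A x x') =
                 qhom B (F x) (F x').

Record dist d (K : quantaloid d) (A B : qcat K) := Dist {
  dval :> forall (x : A) (y : B), hom (typ x) (typ y);
  dist_postcomp : forall x y' y, qhom B y' y ⊚ dval x y' <= dval x y;
  dist_precomp : forall x x' y, dval x' y ⊚ qhom A x x' <= dval x y
}.

Section Distributors.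
Context {d : Order.disp_t} {K : quantaloid d}.
Implicit Types A B C : qcat K.

(** The identity distributor, i.e. the hom of [A] seen as A ⇸ A. *)
Definition dist_id A : dist A A :=
  Dist (fun x y' y => qhom_comp x y' y) (fun x x' y => qhom_comp x x' y).

Section LeftImplication.
Context {A B C} (eta : dist A C) (phi : dist A B).

Let v (y : B) (z : C) : hom (typ y) (typ z) :=
  cinf [set eta x z ↙ phi x y | x in [set: A]].

Let le_v y z (g : hom (typ y) (typ z)) :
  (forall x, g ⊚ phi x y <= eta x z) <-> g <= v y z.
Proof.
split=> [h|gv x]; first by apply: le_cinf => _ [x _ <-]; rewrite le_limpl.
by rewrite -le_limpl; apply: le_trans gv _; apply: cinf_lb; exists x.
Qed.

Fact dist_limpl_post y z' z : qhom C z' z ⊚ v y z' <= v y z.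
Proof.
apply/le_v => x; rewrite -qcompA.
apply: le_trans (dist_postcomp eta x z' z); apply: qcomp_le => //.
by move: x; apply/le_v.
Qed.

Fact dist_limpl_pre y y' z : v y' z ⊚ qhom B y y' <= v y z.
Proof.
apply/le_v => x; rewrite -qcompA.
apply: le_trans (qcomp_le (lexx _) (dist_postcomp phi x y y')) _.
by move: x; apply/le_v.
Qed.

(** η ↙ φ *)
Definition dist_limpl : dist B C := Dist dist_limpl_post dist_limpl_pre.

Lemma le_dist_limpl y z (g : hom (typ y) (typ z)) :
  (forall x, g ⊚ phi x y <= eta x z) <-> g <= dist_limpl y z.
Proof. exact: le_v. Qed.

End LeftImplication.

Section RightImplication.
Context {A B C} (psi : dist B C) (eta : dist A C).

Let v (x : A) (y : B) : hom (typ x) (typ y) :=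
  cinf [set psi y z ↘ eta x z | z in [set: C]].

Let le_v x y (f : hom (typ x) (typ y)) :
  (forall z, psi y z ⊚ f <= eta x z) <-> f <= v x y.
Proof.
split=> [h|fv z]; first by apply: le_cinf => _ [z _ <-]; rewrite le_rimpl.
by rewrite -le_rimpl; apply: le_trans fv _; apply: cinf_lb; exists z.
Qed.

Fact dist_rimpl_post x y' y : qhom B y' y ⊚ v x y' <= v x y.
Proof.
apply/le_v => z; rewrite qcompA.
apply: le_trans (qcomp_le (dist_precomp psi y' y z) (lexx _)) _.
by move: z; apply/le_v.
Qed.

Fact dist_rimpl_pre x x' y : v x' y ⊚ qhom A x x' <= v x y.
Proof.
apply/le_v => z; rewrite qcompA.
apply: le_trans (dist_precomp eta x x' z); apply: qcomp_le => //.
by move: z; apply/le_v.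
Qed.

(** ψ ↘ η *)
Definition dist_rimpl : dist A B := Dist dist_rimpl_post dist_rimpl_pre.

Lemma le_dist_rimpl x y (f : hom (typ x) (typ y)) :
  (forall z, psi y z ⊚ f <= eta x z) <-> f <= dist_rimpl x y.
Proof. exact: le_v. Qed.

End RightImplication.

Fact star_comp (X : K) (x y z : unit) : qid X ⊚ qid X <= qid X.
Proof. by rewrite qcomp1l. Qed.

Definition star (X : K) : qcat K :=
  @QCat d K unit (fun=> X) (fun _ _ => qid X) (fun=> lexx _) (star_comp X).

Definition presheaf A : Type := {X : K & dist A (star X)}.
Definition copresheaf A : Type := {X : K & dist (star X) A}.

Definition PSh_hom A (mu lam : presheaf A) : hom (projT1 mu) (projT1 lam) :=
  dist_limpl (projT2 lam) (projT2 mu) tt tt.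

Lemma le_PSh_hom A (mu lam : presheaf A) (g : hom (projT1 mu) (projT1 lam)) :
  (forall x, g ⊚ projT2 mu x tt <= projT2 lam x tt) <-> g <= PSh_hom mu lam.
Proof. exact: (@le_dist_limpl _ _ _ (projT2 lam) (projT2 mu) tt tt g). Qed.

Fact PSh_id A (mu : presheaf A) : qid (projT1 mu) <= PSh_hom mu mu.
Proof. by apply/le_PSh_hom => x; rewrite qcomp1l. Qed.

Fact PSh_comp A (mu lam nu : presheaf A) :
  PSh_hom lam nu ⊚ PSh_hom mu lam <= PSh_hom mu nu.
Proof.
apply/le_PSh_hom => x; rewrite -qcompA.
have h (al be : presheaf A) : PSh_hom al be ⊚ projT2 al x tt <= projT2 be x tt.
  by move: x; apply/le_PSh_hom.
exact: le_trans (qcomp_le (lexx _) (h mu lam)) (h lam nu).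
Qed.

Definition PSh A : qcat K := QCat (@PSh_id A) (@PSh_comp A).

Definition coPSh_hom A (mu lam : copresheaf A) : hom (projT1 mu) (projT1 lam) :=
  dist_rimpl (projT2 lam) (projT2 mu) tt tt.

Lemma le_coPSh_hom A (mu lam : copresheaf A)
    (g : hom (projT1 mu) (projT1 lam)) :
  (forall x, projT2 lam tt x ⊚ g <= projT2 mu tt x) <-> g <= coPSh_hom mu lam.
Proof. exact: (@le_dist_rimpl _ _ _ (projT2 lam) (projT2 mu) tt tt g). Qed.

Fact coPSh_id A (mu : copresheaf A) : qid (projT1 mu) <= coPSh_hom mu mu.
Proof. by apply/le_coPSh_hom => x; rewrite qcomp1r. Qed.

Fact coPSh_comp A (mu lam nu : copresheaf A) :
  coPSh_hom lam nu ⊚ coPSh_hom mu lam <= coPSh_hom mu nu.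
Proof.
apply/le_coPSh_hom => x; rewrite qcompA.
have h (al be : copresheaf A) : projT2 be tt x ⊚ coPSh_hom al be <= projT2 al tt x.
  by move: x; apply/le_coPSh_hom.
exact: le_trans (qcomp_le (h lam nu) (lexx _)) (h mu lam).
Qed.

Definition coPSh A : qcat K := QCat (@coPSh_id A) (@coPSh_comp A).

(** φ↑(μ) = φ ↙ μ and φ↓(λ) = λ ↘ φ *)
Definition dist_up A B (phi : dist A B) (mu : PSh A) : coPSh B :=
  existT (fun X => dist (star X) B) (projT1 mu) (dist_limpl phi (projT2 mu)).
Definition dist_down A B (phi : dist A B) (lam : coPSh B) : PSh A :=
  existT (fun X => dist A (star X)) (projT1 lam) (dist_rimpl (projT2 lam) phi).

(** A(a,-) *)
Fact corep_pre A (a : A) (x x' : star (typ a)) (y : A) :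
  qhom A a y ⊚ qhom (star (typ a)) x x' <= qhom A a y.
Proof. by rewrite /= qcomp1r. Qed.

Definition corep A (a : A) : coPSh A :=
  existT (fun X => dist (star X) A) (typ a)
    (@Dist d K (star (typ a)) A (fun _ y => qhom A a y)
       (fun _ y' y => qhom_comp a y' y) (@corep_pre A a)).

Definition separated A : Prop :=
  forall (x y : A) (e : typ x = typ y),
    hom_cast (erefl (typ x)) e (qid (typ x)) <= qhom A x y ->
    hom_cast e (erefl (typ x)) (qid (typ x)) <= qhom A y x ->
    x = y.

(** The equation in [coPSh A] says that [a] and [mu] have the same type and
    A(a,-) = A ↙ μ. *)
Definition complete A : Prop :=
  forall mu : PSh A, exists a : A, corep a = dist_up (dist_id A) mu.

Record concept A B (phi : dist A B) := Concept {
  extent : PSh A;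
  intent : coPSh B;
  intentE : intent = dist_up phi extent;
  extentE : extent = dist_down phi intent
}.

(** The hom is taken between extents; by [concept_homE] below it agrees with
    the hom between intents. *)
Definition concept_lattice A B (phi : dist A B) : qcat K :=
  @QCat d K (concept phi) (fun c => typ (extent c))
    (fun c c' => qhom (PSh A) (extent c) (extent c'))
    (fun c => qhom_id (extent c))
    (fun c c' c'' => qhom_comp (extent c) (extent c') (extent c'')).

Lemma concept_typE A B (phi : dist A B) (c : concept phi) :
  typ (extent c) = typ (intent c).
Proof. by rewrite (intentE c). Qed.

Lemma up_down_homE A B (phi : dist A B) (mu : PSh A) (lam : coPSh B) :
  qhom (PSh A) mu (dist_down phi lam) = qhom (coPSh B) (dist_up phi mu) lam.
Proof.
have hP : forall x, qhom (PSh A) mu (dist_down phi lam) ⊚ projT2 mu x tt <=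
                    projT2 (dist_down phi lam) x tt.
  exact: (proj2 (le_PSh_hom (lam := dist_down phi lam) _) (lexx _)).
have hC : forall y, projT2 lam tt y ⊚ qhom (coPSh B) (dist_up phi mu) lam <=
                    projT2 (dist_up phi mu) tt y.
  exact: (proj2 (le_coPSh_hom (mu := dist_up phi mu) _) (lexx _)).
apply: le_anti; apply/andP; split.
  refine (proj1 (le_coPSh_hom (mu := dist_up phi mu) _) _) => y.
  refine (proj1 (le_dist_limpl phi (projT2 mu) (y := tt) _) _) => x.
  rewrite -qcompA; apply: le_trans (qcomp_le (lexx _) (hP x)) _.
  exact: (proj2 (le_dist_rimpl (projT2 lam) phi (y := tt) _) (lexx _)).
refine (proj1 (le_PSh_hom (lam := dist_down phi lam) _) _) => x.
refine (proj1 (le_dist_rimpl (projT2 lam) phi (y := tt) _) _) => y.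
rewrite qcompA; apply: le_trans (qcomp_le (hC y) (lexx _)) _.
exact: (proj2 (le_dist_limpl phi (projT2 mu) (y := tt) _) (lexx _)).
Qed.

Lemma concept_homE A B (phi : dist A B) (c c' : concept phi) :
  hom_cast (concept_typE c) (concept_typE c')
    (qhom (PSh A) (extent c) (extent c')) =
  qhom (coPSh B) (intent c) (intent c').
Proof.
move: (concept_typE c) (concept_typE c').
case: c c' => [mu lam eI _] [mu' lam' _ eE] /=; subst lam mu' => e e'.
rewrite (Prop_irrelevance e erefl) (Prop_irrelevance e' erefl).
exact: up_down_homE.
Qed.

End Distributors.

Section DiagonalQuantaloid.
Context {d : Order.disp_t} {Q : divQuantaleType d}.
Implicit Types X Y Z W : Q.

(** Arrows X → Y are the α ≤ X ∧ Y in Q, ordered as in Q; joins of arrows are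
    joins in Q. *)
Record dhom X Y := DHom { dhom_val :> Q; dhomP : dhom_val <= X `&` Y }.

HB.instance Definition _ X Y := [isSub for @dhom_val X Y].
HB.instance Definition _ X Y := [Choice of dhom X Y by <:].
HB.instance Definition _ X Y := [SubChoice_isSubPOrder of dhom X Y by <: with d].

Fact dhom_sup_subproof X Y (S : set (dhom X Y)) :
  csup [set (f : Q) | f in S] <= X `&` Y.
Proof. by apply: csup_le => _ [f _ <-]; apply: dhomP. Qed.

Definition dhom_sup X Y (S : set (dhom X Y)) : dhom X Y :=
  DHom (dhom_sup_subproof S).

Fact dhom_supP X Y (S : set (dhom X Y)) : isLub S (dhom_sup S).
Proof.
split=> [f Sf|g ub]; first by apply: csup_ub; exists f.
by apply: csup_le => _ [f Sf <-]; apply: ub.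
Qed.

HB.instance Definition _ X Y :=
  POrder_isCompleteLattice.Build d (dhom X Y) (@dhom_supP X Y).

Lemma dhom_lel X Y (f : dhom X Y) : f <= X :> Q.
Proof. exact: le_trans (dhomP f) (leIl _ _). Qed.

Lemma dhom_ler X Y (f : dhom X Y) : f <= Y :> Q.
Proof. exact: le_trans (dhomP f) (leIr _ _). Qed.

(** The two formulas for the composite β ∘ α agree. *)
Lemma dcompE X Y Z (g : dhom Y Z) (f : dhom X Y) :
  dhom_val g * ldiv Y (dhom_val f) = rdiv (dhom_val g) Y * dhom_val f.
Proof.
by rewrite -{1}(mul_rdiv (dhom_lel g)) -mulgA (mul_ldiv (dhom_ler f)).
Qed.

Fact dcomp_subproof X Y Z (g : dhom Y Z) (f : dhom X Y) :
  dhom_val g * ldiv Y (dhom_val f) <= X `&` Z.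
Proof.
rewrite lexI; apply/andP; split.
  rewrite dcompE; apply: le_trans (dhom_lel f).
  by rewrite -[leRHS]mul1g; apply/lemul2r/one_top.
apply: le_trans (dhom_ler g).
by rewrite -[leRHS]mulg1; apply/lemul2l/one_top.
Qed.

Definition dcomp X Y Z (g : dhom Y Z) (f : dhom X Y) : dhom X Z :=
  DHom (dcomp_subproof g f).

Fact did_subproof X : X <= X `&` X.
Proof. by rewrite meetxx. Qed.

Definition did X : dhom X X := DHom (did_subproof X).

Fact dcompA X Y Z W (h : dhom Z W) (g : dhom Y Z) (f : dhom X Y) :
  dcomp h (dcomp g f) = dcomp (dcomp h g) f.
Proof.
apply: val_inj => /=; have /= -> := dcompE h (dcomp g f).
by rewrite mulgA -dcompE.
Qed.

Fact dcomp1l X Y (f : dhom X Y) : dcomp (did Y) f = f.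
Proof. by apply: val_inj; rewrite /= (mul_ldiv (dhom_ler f)). Qed.

Fact dcomp1r X Y (f : dhom X Y) : dcomp f (did X) = f.
Proof.
apply: val_inj => /=; have /= -> := dcompE f (did X).
exact: mul_rdiv (dhom_lel f).
Qed.

Fact dcomp_csupl X Y Z (S : set (dhom Y Z)) (f : dhom X Y) :
  dcomp (csup S) f = csup [set dcomp g f | g in S].
Proof.
apply: val_inj; rewrite /= csup_mulg; congr csup.
by rewrite !image_comp.
Qed.

Fact dcomp_csupr X Y Z (g : dhom Y Z) (S : set (dhom X Y)) :
  dcomp g (csup S) = csup [set dcomp g f | f in S].
Proof.
apply: val_inj => /=; have /= -> := dcompE g (csup S).
rewrite mulg_csup; congr csup.
by rewrite !image_comp; apply: eq_imagel => f _ /=; rewrite -dcompE.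
Qed.

End DiagonalQuantaloid.

Definition diag d (Q : divQuantaleType d) : quantaloid d :=
  Quantaloid (@dcompA d Q) (@dcomp1l d Q) (@dcomp1r d Q)
    (@dcomp_csupl d Q) (@dcomp_csupr d Q).

(** The type map of an object of this structure is its degree of membership:
    1_X = X forces A(x,x) = typ x. *)
Notation preordered_qsubset Q := (qcat (diag Q)).

Record qsubset d (Q : divQuantaleType d) := QSubset {
  qsub_carrier :> Type;
  qsub_deg : qsub_carrier -> Q
}.

Section Discrete.
Context {d : Order.disp_t} {Q : divQuantaleType d} (A : qsubset Q).

Definition disc_val (x y : A) : Q := if `[< x = y >] then qsub_deg x else \bot.

Fact disc_subproof x y : disc_val x y <= qsub_deg x `&` qsub_deg y.
Proof.
by rewrite /disc_val; case: asboolP => [->|_]; rewrite ?meetxx ?le0x.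
Qed.

Definition disc_hom (x y : A) : @hom d (diag Q) (qsub_deg x) (qsub_deg y) :=
  DHom (disc_subproof x y).

Fact disc_id x : @qid d (diag Q) (qsub_deg x) <= disc_hom x x.
Proof. by rewrite -[_ <= _]/(qsub_deg x <= disc_val x x) /disc_val asboolT. Qed.

Fact disc_comp x y z : disc_hom y z ⊚ disc_hom x y <= disc_hom x z.
Proof.
rewrite -[_ <= _]/(disc_val y z * ldiv (qsub_deg y) (disc_val x y)
                   <= disc_val x z).
have := dcompE (disc_hom y z) (disc_hom x y); rewrite /=.
rewrite /disc_val; case: (asboolP (y = z)) => [<- _|_ _].
  by rewrite mul_ldiv //; case: asboolP => [->|].
apply: le_trans (le0x _).
by rewrite -[leRHS]mulg1; apply/lemul2l/one_top.
Qed.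

Definition discrete : preordered_qsubset Q := QCat disc_id disc_comp.

End Discrete.

Definition qrelation d (Q : divQuantaleType d) (A B : qsubset Q) : Type :=
  dist (discrete A) (discrete B).

Record fuzzy_context d (Q : divQuantaleType d) := FuzzyContext {
  ctx_obj : qsubset Q;
  ctx_attr : qsubset Q;
  ctx_rel : qrelation ctx_obj ctx_attr
}.

Definition formal_concept_lattice d (Q : divQuantaleType d)
    (c : fuzzy_context Q) : preordered_qsubset Q :=
  concept_lattice (ctx_rel c).

(* Main.v *)
(** Completeness: for a presheaf [M] on the concept lattice, let [mu] be the
    [M]-weighted join of the extents. The concept whose extent is the closure of
    [mu] under [dist_down phi \o dist_up phi] is the colimit of [M], because
    homs from [mu] into an extent equal homs from the closure of [mu].
    Conversely, [A] is the lattice of its own hom, read as a relation on the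
    underlying discrete Q-subset: by the Yoneda lemma [a] gives the concept
    [(A(-,a), A(a,-))], and because an extent has the form λ ↘ A it is
    automatically a presheaf on [A] itself, so completeness represents it. *)
Require Import Defs.
From mathcomp Require Import all_boot all_order.
From mathcomp Require Import boolp classical_sets.

Set Implicit Arguments.
Unset Strict Implicit.
Unset Printing Implicit Defensive.

Import Order.TTheory.
Local Open Scope order_scope.
Local Open Scope quantaloid_scope.

Section DistributorTheory.
Context {d : Order.disp_t} {K : quantaloid d}.
Implicit Types A B C : qcat K.

(** * Extensionality and evaluation of distributors *)

Lemma dist_ext A B (f g : dist A B) : (forall x y, f x y = g x y) -> f = g.
Proof.
case: f g => f f1 f2 [g g1 g2] /= fg.
have e : f = g by apply: functional_extensionality_dep => x;
  apply: functional_extensionality_dep => y; apply: fg.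
by subst g; congr Dist; apply: Prop_irrelevance.
Qed.

Lemma dist_limplP A B C (eta : dist A C) (phi : dist A B) x y z :
  dist_limpl eta phi y z ⊚ phi x y <= eta x z.
Proof. by move: x; apply/le_dist_limpl. Qed.

Lemma dist_rimplP A B C (psi : dist B C) (eta : dist A C) x y z :
  psi y z ⊚ dist_rimpl psi eta x y <= eta x z.
Proof. by move: z; apply/le_dist_rimpl. Qed.

Lemma PSh_homP A (mu lam : PSh A) x :
  qhom (PSh A) mu lam ⊚ projT2 mu x tt <= projT2 lam x tt.
Proof. exact: (proj2 (le_PSh_hom _) (lexx _)). Qed.

(** * Composition of distributors and currying of implications *)

Section Composition.
Context {A B C} (psi : dist B C) (phi : dist A B).

Let v x z : hom (typ x) (typ z) :=
  csup [set psi y z ⊚ phi x y | y in [set: B]]%classic.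

Let v_ub x y z : psi y z ⊚ phi x y <= v x z.
Proof. by apply: csup_ub; exists y. Qed.

Let v_le x z h : (forall y, psi y z ⊚ phi x y <= h) -> v x z <= h.
Proof. by move=> H; apply: csup_le => _ [y _ <-]; apply: H. Qed.

Fact dist_comp_post x z' z : qhom C z' z ⊚ v x z' <= v x z.
Proof.
rewrite -le_rimpl; apply: v_le => y; rewrite le_rimpl qcompA.
exact: le_trans (qcomp_le (dist_postcomp psi y z' z) (lexx _)) (v_ub x y z).
Qed.

Fact dist_comp_pre x x' z : v x' z ⊚ qhom A x x' <= v x z.
Proof.
rewrite -le_limpl; apply: v_le => y; rewrite le_limpl -qcompA.
exact: le_trans (qcomp_le (lexx _) (dist_precomp phi x x' y)) (v_ub x y z).
Qed.

Definition dist_comp : dist A C := Dist dist_comp_post dist_comp_pre.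

Lemma dist_comp_le x z (h : hom (typ x) (typ z)) :
  (forall y, psi y z ⊚ phi x y <= h) <-> dist_comp x z <= h.
Proof.
by split=> [|H y]; [apply: v_le | apply: le_trans H; apply: v_ub].
Qed.

End Composition.

(** A lower bound [g] of either side is the same data: [g ⊚ psi y z ⊚ phi x y <= eta x w] for all
    [x] and [y]. *)
Lemma dist_limpl_comp A B C D (eta : dist A D) (psi : dist B C) (phi : dist A B) :
  dist_limpl eta (dist_comp psi phi) = dist_limpl (dist_limpl eta phi) psi.
Proof.
apply: dist_ext => z w; apply: le_anti; apply/andP; split.
  apply/le_dist_limpl => y; apply/le_dist_limpl => x.
  rewrite -qcompA; apply: le_trans (dist_limplP eta (dist_comp psi phi) x z w).
  by apply: qcomp_le => //; move: y; apply/dist_comp_le.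
apply/le_dist_limpl => x; rewrite -le_rimpl; apply/dist_comp_le => y.
rewrite le_rimpl qcompA; apply: le_trans (dist_limplP eta phi x y w).
by apply: qcomp_le => //; apply: dist_limplP.
Qed.

(** * The closure operator of a distributor *)

Lemma dist_limpl_rimpl_limpl A B C (phi : dist A B) (mu : dist A C) :
  dist_limpl phi (dist_rimpl (dist_limpl phi mu) phi) = dist_limpl phi mu.
Proof.
apply: dist_ext => z y; apply: le_anti; apply/andP; split.
  apply/le_dist_limpl => x.
  (* [mu] lies below its closure, and implication is antitone in its second argument. *)
  apply: le_trans (qcomp_le (lexx _) _) (dist_limplP _ _ x z y).
  by apply/le_dist_rimpl => y'; apply: dist_limplP.
by apply/le_dist_limpl => x; apply: dist_rimplP.
Qed.

Lemma dist_up_down_up A B (phi : dist A B) (mu : PSh A) :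
  dist_up phi (dist_down phi (dist_up phi mu)) = dist_up phi mu.
Proof. by congr existT; apply: dist_limpl_rimpl_limpl. Qed.

(** By the adjunction both homs become homs into [lam], from copresheaves that the triangle identity
    makes equal. *)
Lemma PSh_hom_closure A B (phi : dist A B) (mu : PSh A) (lam : coPSh B) :
  qhom (PSh A) (dist_down phi (dist_up phi mu)) (dist_down phi lam) =
  qhom (PSh A) mu (dist_down phi lam).
Proof.
rewrite [RHS]up_down_homE [LHS]up_down_homE.
(* Rewriting second components at a fixed type avoids transport along an equality of dependent
   pairs. *)
exact: (congr1 (fun f => @dist_rimpl d K (star _) (star _) B (projT2 lam) f tt tt)
  (dist_limpl_rimpl_limpl phi (projT2 mu))).
Qed.

(** * Concept lattices: separatedness and completeness *)

Definition concept_of A B (phi : dist A B) (mu : PSh A) : concept phi :=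
  @Concept _ _ _ _ phi (dist_down phi (dist_up phi mu)) (dist_up phi mu)
    (esym (dist_up_down_up phi mu)) erefl.

Lemma concept_ext A B (phi : dist A B) (c c' : concept phi) :
  extent c = extent c' -> c = c'.
Proof.
case: c c' => [mu lam e1 e2] [mu' lam' e1' e2'] /= E.
have E' : lam = lam' by rewrite e1 e1' E.
case: _ / E e1' e2' => e1' e2'; case: _ / E' e1' e2' => e1' e2'.
by rewrite (Prop_irrelevance e1 e1') (Prop_irrelevance e2 e2').
Qed.

(** A hom above the identity, composed with its source presheaf, bounds that presheaf by the target;
    doing this both ways gives equality. *)
Lemma PSh_separated A : separated (PSh A).
Proof.
case=> [X mu] [X' lam] /= e; subst X' => l1 l2.
pose P : dist A (star X) -> PSh A := existT (fun X => dist A (star X)) X.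
congr existT; apply: dist_ext => x []; apply: le_anti; apply/andP; split.
  rewrite -[leLHS]qcomp1l; apply: le_trans (qcomp_le l1 (lexx _)) _.
  exact: (PSh_homP (P mu) (P lam) x).
rewrite -[leLHS]qcomp1l; apply: le_trans (qcomp_le l2 (lexx _)) _.
exact: (PSh_homP (P lam) (P mu) x).
Qed.

Lemma concept_lattice_separated A B (phi : dist A B) :
  separated (concept_lattice phi).
Proof.
by move=> c c' e l1 l2; apply: concept_ext; apply: (PSh_separated (e := e)).
Qed.

Fact extent_dist_post A B (phi : dist A B) x (c c' : concept_lattice phi) :
  qhom (concept_lattice phi) c c' ⊚ projT2 (extent c) x tt
    <= projT2 (extent c') x tt.
Proof. exact: PSh_homP. Qed.

Fact extent_dist_pre A B (phi : dist A B) x x' (c : concept_lattice phi) :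
  projT2 (extent c) x' tt ⊚ qhom A x x' <= projT2 (extent c) x tt.
Proof. exact: (dist_precomp (projT2 (extent c))). Qed.

(** Evaluation of extents at objects; composing a presheaf on the lattice with it yields the
    weighted join of the extents. *)
Definition extent_dist A B (phi : dist A B) : dist A (concept_lattice phi) :=
  Dist (@extent_dist_post A B phi) (@extent_dist_pre A B phi).

Lemma concept_lattice_complete A B (phi : dist A B) :
  complete (concept_lattice phi).
Proof.
case=> X M.
pose mu : PSh A :=
  existT (fun X => dist A (star X)) X (dist_comp M (extent_dist phi)).
exists (concept_of phi mu).
congr existT; apply: dist_ext => -[] c /=.
rewrite [LHS](_ : _ = qhom (PSh A) mu (extent c)); last first.
  (* The target must have the form [dist_down phi _] for the closure of [mu] to be replaced by
     [mu]. *)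
  by rewrite (extentE c); exact: (PSh_hom_closure phi mu).
(* After currying, the inner implication from [extent_dist phi] to the extent of [c] is by
   definition the hom of the lattice into [c]. *)
exact: (congr1 (fun f : dist (star X) (star _) => f tt tt)
  (dist_limpl_comp (projT2 (extent c)) M (extent_dist phi))).
Qed.

(** * Representation of a category by its own hom *)

(** Two hom structures [h <= qhom A] on the same typed set; the instance needed
    is the discrete one. *)
Section Representation.
Context (A : qcat K) (h : forall x y : A, hom (typ x) (typ y)).
Hypotheses (h_id : forall x, qid (typ x) <= h x x)
  (h_comp : forall x y z, h y z ⊚ h x y <= h x z)
  (h_le : forall x y, h x y <= qhom A x y).

Let D : qcat K := QCat h_id h_comp.

Fact coarse_post (x : D) (y' y : D) : h y' y ⊚ qhom A x y' <= qhom A x y.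
Proof. exact: le_trans (qcomp_le (h_le _ _) (lexx _)) (qhom_comp _ _ _). Qed.

Fact coarse_pre (x x' y : D) : qhom A x' y ⊚ h x x' <= qhom A x y.
Proof. exact: le_trans (qcomp_le (lexx _) (h_le _ _)) (qhom_comp _ _ _). Qed.

Definition coarse_dist : dist D D :=
  @Dist _ _ D D (fun x y => qhom A x y) coarse_post coarse_pre.

Fact coarse_rep_post a (x : D) (y' y : star (typ a)) :
  qhom (star (typ a)) y' y ⊚ qhom A x a <= qhom A x a.
Proof. by rewrite qcomp1l. Qed.

Definition coarse_rep (a : A) : PSh D :=
  existT (fun X => dist D (star X)) (typ a)
    (@Dist _ _ D (star (typ a)) (fun x _ => qhom A x a)
       (@coarse_rep_post a) (fun x x' _ => coarse_pre x x' a)).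

Fact coarse_corep_pre a (x x' : star (typ a)) (y : D) :
  qhom A a y ⊚ qhom (star (typ a)) x x' <= qhom A a y.
Proof. by rewrite qcomp1r. Qed.

Definition coarse_corep (a : A) : coPSh D :=
  existT (fun X => dist (star X) D) (typ a)
    (@Dist _ _ (star (typ a)) D (fun _ y => qhom A a y)
       (fun _ => coarse_post a) (@coarse_corep_pre a)).

(** Yoneda: composition in [A] gives one inequality, and evaluation at [a] followed by the unit law
    gives the other. *)
Lemma coarse_corepE a : coarse_corep a = dist_up coarse_dist (coarse_rep a).
Proof.
congr existT; apply: dist_ext => -[] y; apply: le_anti; apply/andP; split.
  by apply/le_dist_limpl => x; exact: (@qhom_comp _ _ A).
rewrite -[leLHS]qcomp1r; apply: le_trans (qcomp_le (lexx _) (qhom_id a)) _.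
exact: (dist_limplP coarse_dist (projT2 (coarse_rep a)) a tt y).
Qed.

Lemma coarse_repE a : coarse_rep a = dist_down coarse_dist (coarse_corep a).
Proof.
congr existT; apply: dist_ext => x []; apply: le_anti; apply/andP; split.
  by apply/le_dist_rimpl => y; exact: (@qhom_comp _ _ A).
rewrite -[leLHS]qcomp1l; apply: le_trans (qcomp_le (qhom_id a) (lexx _)) _.
exact: (dist_rimplP (projT2 (coarse_corep a)) coarse_dist x tt a).
Qed.

Definition rep_concept (a : A) : concept_lattice coarse_dist :=
  Concept (coarse_corepE a) (coarse_repE a).

Lemma rep_concept_hom a b :
  qhom A a b = qhom (concept_lattice coarse_dist) (rep_concept a) (rep_concept b).
Proof.
apply: le_anti; apply/andP; split.
  apply: (proj1 (le_PSh_hom (mu := coarse_rep a) (lam := coarse_rep b) _)) => x.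
  exact: (@qhom_comp _ _ A).
rewrite -[leLHS]qcomp1r; apply: le_trans (qcomp_le (lexx _) (qhom_id a)) _.
exact: (PSh_homP (coarse_rep a) (coarse_rep b) a).
Qed.

Fact rep_concept_hom_le a b :
  qhom A a b <= qhom (concept_lattice coarse_dist) (rep_concept a) (rep_concept b).
Proof. by rewrite -rep_concept_hom. Qed.

Definition rep_functor : qfunctor A (concept_lattice coarse_dist) :=
  @QFunctor _ _ A (concept_lattice coarse_dist) rep_concept (fun=> erefl)
    rep_concept_hom_le.

Lemma rep_concept_inj : separated A -> injective rep_concept.
Proof.
move=> sA a b ab.
(* Stating this for arbitrary [x], [y] allows substitution, after which the cast is trivial by proof
   irrelevance. *)
have unit_le (B : qcat K) (x y : B) (e : typ x = typ y) : x = y ->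
    hom_cast (erefl (typ x)) e (qid (typ x)) <= qhom B x y /\
    hom_cast e (erefl (typ x)) (qid (typ x)) <= qhom B y x.
  move=> xy; subst y; rewrite (Prop_irrelevance e erefl).
  by split; apply: qhom_id.
have e : typ a = typ b := congr1 (@typ _ _ _) ab.
have [l1 l2] := unit_le _ (rep_concept a) (rep_concept b) e ab.
by apply: (sA a b e); rewrite rep_concept_hom.
Qed.

Fact extent_presheaf_pre (c : concept coarse_dist) (x x' : A)
    (y : star (projT1 (extent c))) :
  projT2 (extent c) x' y ⊚ qhom A x x' <= projT2 (extent c) x y.
Proof.
case: c y => mu [X lam] /= _ -> /= [].
apply: (proj1 (le_dist_rimpl lam coarse_dist (y := tt) _)) => z.
rewrite qcompA; apply: le_trans (qhom_comp x x' z); apply: qcomp_le => //.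
exact: (dist_rimplP lam coarse_dist).
Qed.

Definition extent_presheaf (c : concept coarse_dist) : PSh A :=
  existT (fun X => dist A (star X)) (projT1 (extent c))
    (@Dist _ _ A (star (projT1 (extent c))) (projT2 (extent c))
      (fun x => dist_postcomp (projT2 (extent c)) x)
      (@extent_presheaf_pre c)).

Fact coarsen_post X (lam : dist (star X) A) x (y' y : D) :
  h y' y ⊚ lam x y' <= lam x y.
Proof. exact: le_trans (qcomp_le (h_le _ _) (lexx _)) (dist_postcomp _ _ _ _). Qed.

(** Restriction along the identity map from [D] to [A], used to carry equations of copresheaves on
    [A] over to [D]. *)
Definition coarsen (lam : coPSh A) : coPSh D :=
  existT (fun X => dist (star X) D) (projT1 lam)
    (@Dist _ _ (star (projT1 lam)) D (projT2 lam)
      (@coarsen_post _ (projT2 lam)) (@dist_precomp _ _ _ _ (projT2 lam))).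

(** Completeness supplies [a] whose corepresentable is the intent of [c]; equal intents then force
    equal extents. *)
Lemma rep_concept_surj (c : concept coarse_dist) :
  complete A -> exists a, rep_concept a = c.
Proof.
move=> /(_ (extent_presheaf c)) [a /(congr1 coarsen) E]; exists a.
apply: concept_ext; rewrite [RHS]extentE /= coarse_repE; congr dist_down.
rewrite intentE; transitivity (coarsen (corep a)).
  (* The values agree by definition; only the proofs of the distributor laws differ. *)
  by congr existT; apply: dist_ext.
by rewrite E; congr existT; apply: dist_ext.
Qed.

Lemma rep_functor_iso : separated A -> complete A ->
  isomorphic A (concept_lattice coarse_dist).
Proof.
move=> sA cA; exists rep_functor; split; last exact: rep_concept_hom.
have surj c : exists a, rep_concept a = c by apply: rep_concept_surj.
(* The inverse picks a preimage of each concept; injectivity makes it a left inverse as well. *)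
have [g gK] := choice surj.
by exists g => // a; apply: rep_concept_inj.
Qed.

End Representation.
End DistributorTheory.

(** * Fuzzy contexts over a divisible quantale *)

Lemma disc_hom_le d (Q : divQuantaleType d) (A : preordered_qsubset Q) (x y : A) :
  @disc_hom d Q (QSubset (@typ _ _ A)) x y <= qhom A x y.
Proof.
rewrite -[_ <= _]/(disc_val (A := QSubset (@typ _ _ A)) x y
                     <= dhom_val (qhom A x y)).
(* On the diagonal the degree is the identity arrow, so the unit law of [A] applies; elsewhere the
   value is bottom. *)
rewrite /disc_val; case: asboolP => [->|_]; last exact: le0x.
exact: (qhom_id y).
Qed.

Theorem theorem7p3p1 (d : Order.disp_t) (Q : divQuantaleType d) :
  (forall c : fuzzy_context Q,
     separated (formal_concept_lattice c) /\ complete (formal_concept_lattice c)) /\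
  (forall A : preordered_qsubset Q,
     separated A -> complete A ->
     exists c : fuzzy_context Q, isomorphic A (formal_concept_lattice c)).
Proof.
split=> [c|A sA cA].
  by split; [apply: concept_lattice_separated | apply: concept_lattice_complete].
pose D := QSubset (@typ _ _ A).
exists (@FuzzyContext d Q D D
  (coarse_dist (@disc_id d Q D) (@disc_comp d Q D) (@disc_hom_le d Q A))).
exact: rep_functor_iso.
Qed.
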